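(* There is an absolute constant $c>0$ such that for every $N\in\mathbb{N}$ there exists an orthonormal system $\varphi_1,\ldots,\varphi_N\in D_N(0,1)$ (orthonormal in $L_2(0,1)$) with $$ d_n^{\mathrm{avg}}(\{\varphi_1,\ldots,\varphi_N\},L_0(0,1))\ge c\quad\text{if } n\le cN. $$
   Context: $D_N(0,1)$ is the set of functions on $(0,1)$ that are constant on each interval $(\frac{j-1}N,\frac jN)$, $j=1,\ldots,N$. $L_0(0,1)$ is the space of measurable real functions on $(0,1)$ (Lebesgue measure $\mu$) with $\|f\|_{L_0}=\sup\{t\ge 0\colon\mu\{x\colon|f(x)|\ge t\}\ge t\}$ and distance $\|f-g\|_{L_0}$. $d_n^{\mathrm{avg}}(\{x_1,\ldots,x_N\},X)=\inf_{Q_n}\frac1N\sum_{i=1}^N\inf_{y\in Q_n}\|x_i-y\|_X$, the infimum being over linear subspaces $Q_n\subset X$ of dimension at most $n$. *)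

(* Defs.v *)
From HB Require Import structures.
From mathcomp Require Import all_boot all_order all_algebra.
From mathcomp Require Import all_classical all_reals all_analysis.
Set Implicit Arguments.
Unset Strict Implicit.
Unset Printing Implicit Defensive.
Import Order.TTheory GRing.Theory Num.Theory.
Import numFieldNormedType.Exports.
Local Open Scope classical_set_scope.
Local Open Scope ring_scope.

(* A function on (0,1) is represented by a function R -> R whose values
   outside (0,1) are irrelevant. *)
Definition unit_itv (R : realType) : set R := `]0, 1[%classic.

(* The index i : 'I_N is 0-based.  Values at the breakpoints are free. *)
Definition DN (R : realType) (N : nat) : set (R -> R) :=
  [set f | forall i : 'I_N, exists a : R,
     forall x, x \in `]i%:R / N%:R, i.+1%:R / N%:R[ -> f x = a].

Definition L2_inner (R : realType) (f g : R -> R) : R :=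
  \int[@lebesgue_measure R]_(x in @unit_itv R) (f x * g x).

Definition orthonormal_L2 (R : realType) (N : nat) (phi : 'I_N -> R -> R) :=
  forall i j : 'I_N, L2_inner (phi i) (phi j) = (i == j)%:R.

Definition L0 (R : realType) : set (R -> R) :=
  [set f | measurable_fun (@unit_itv R) f].

(* The set below contains 0 and is bounded above by 1, so the real-valued
   supremum is the genuine one. *)
Definition L0norm (R : realType) (f : R -> R) : R :=
  sup [set t : R | 0 <= t /\
    (t%:E <= @lebesgue_measure R
               (@unit_itv R `&` [set x | (t <= `|f x|)%R]))%E].

(* Linear subspaces of L_0 of dimension at most n.  Elements of L_0 are
   classes modulo a.e. equality on (0,1), hence Q is spanned by n of its
   elements up to a.e. equality. *)
Definition subspace_dim_le (R : realType) (n : nat) (Q : set (R -> R)) :=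
  [/\ Q `<=` @L0 R,
      GRing.submod_closed (mem Q) &
      exists2 g : 'I_n -> R -> R, forall i, Q (g i) &
        forall f, Q f -> exists a : 'I_n -> R,
          ae_eq (@lebesgue_measure R) (@unit_itv R)
                f (\sum_(i < n) a i *: g i)].

Definition L0dist_to (R : realType) (f : R -> R) (Q : set (R -> R)) : R :=
  inf [set L0norm (f - y) | y in Q].

Definition davg_L0 (R : realType) (n N : nat) (x : 'I_N -> R -> R) : R :=
  inf [set N%:R^-1 * \sum_(i < N) L0dist_to (x i) Q
      | Q in [set Q | subspace_dim_le n Q]].

(* Main.v *)
Require Import Defs.
From mathcomp Require Import all_boot all_order all_algebra.
From mathcomp Require Import all_classical all_reals all_analysis.
From mathcomp Require Import measurable_realfun.
From mathcomp Require Import ring lra zify.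
Set Implicit Arguments.
Unset Strict Implicit.
Unset Printing Implicit Defensive.
Import Order.TTheory GRing.Theory Num.Theory.
Local Open Scope ring_scope.

(** The system is obtained by counting sign matrices.

    Identify D_N(0,1) with R^N and put p of order gamma N, with gamma a small
    absolute constant.  If y_r in Q is a good L_0-approximation of a function
    phi_r for most r <= p, then a suitable choice of one sample point in each
    of the N intervals turns the y_r into a p x N matrix B with rank at most n
    which is within 1/40 of the matrix of values of the phi_r at all but a
    small proportion of the entries ([sample_points]).  Nothing is known about
    B at the exceptional entries, where it may be huge, so Hilbert space
    estimates are of no use and the obstruction has to come from the rank.

    The heart of the proof is the bound [card_signs_near_low_rank]: at most
    (6/5)^(pN) sign matrices of size p x N are close in this sense to a matrix
    of rank n, when n is a small multiple of N.  Fix the set G of good entries,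
    let F be the sign matrices V having an approximant B_V = X_V Y_V which is
    close to V on G, and consider the kernel

      E(U, V) = prod_(k in G) (1 + U_k B_V(k))     (U, V in F).

    As a function of V it is a polynomial of degree at most 2|G| in the few
    entries of X_V and Y_V, so the rank of E is at most the number of monomials
    of that degree.  On the diagonal every factor is close to 2, while
    summing E(U, V)^2 over all sign matrices U gives a product of factors
    2 + 2 B_V(k)^2, close to 4.  The inequality tr(E)^2 <= rank(E) |E|_F^2 then
    bounds |F| by the number of monomials times a factor (1 + small)^(pN).
    Summing over the sets G costs only another such factor.  The argument
    plays the role of Warren's bound for the number of sign patterns of a
    family of polynomials, and it is elementary because the values B_V(k) are
    known up to a small error and not only in sign.

    On the other hand more than (6/5)^(pN) sign matrices are close in the mean
    to sqrt(N) Phi for some Phi with orthonormal rows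
    ([card_near_orthonormal]): when k <= gamma N orthonormal rows are given,
    three quarters of the sign vectors have a projection of squared norm at
    most 4k onto their span, and one step of the Gram-Schmidt process changes
    such a vector very little.  Hence some Phi stays far from all matrices of
    rank n; it is completed to an orthogonal matrix and gives the system. *)

(** * The trace of a kernel of low rank *)

Lemma sum_sqr_eq0 (R : realDomainType) (I : finType) (f : I -> R) :
  \sum_i f i ^+ 2 = 0 -> forall i, f i = 0.
Proof.
move=> /eqP; rewrite psumr_eq0 => [/allP H i|i _]; last exact: sqr_ge0.
by have := H i (mem_index_enum i); rewrite sqrf_eq0 => /eqP.
Qed.

Lemma cauchy_schwarz_sum (R : realFieldType) (I : finType) (f g : I -> R) :
  (\sum_i f i * g i) ^+ 2 <= (\sum_i f i ^+ 2) * (\sum_i g i ^+ 2).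
Proof.
set a := \sum_i f i * g i; set b := \sum_i f i ^+ 2; set c := \sum_i g i ^+ 2.
have b0 : 0 <= b by apply: sumr_ge0 => i _; exact: sqr_ge0.
have H t : 0 <= c - 2 * t * a + t ^+ 2 * b.
  rewrite (_ : _ + _ = \sum_i (g i - t * f i) ^+ 2).
    by apply: sumr_ge0 => i _; exact: sqr_ge0.
  rewrite /a /b /c !mulr_sumr -sumrB -big_split /=.
  by apply: eq_bigr => i _; ring.
have [b00|bn0] := eqVneq b 0.
  have a0 : a = 0 by apply: big1 => i _; rewrite (sum_sqr_eq0 b00) mul0r.
  by rewrite a0 b00 expr0n mul0r.
have bp : 0 < b by rewrite lt_def bn0.
rewrite -subr_ge0 (_ : _ - _ = (c - 2 * (a / b) * a + (a / b) ^+ 2 * b) * b).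
  exact: mulr_ge0.
by field.
Qed.

Lemma mxtrace_mul_tr (R : comPzRingType) (m n : nat) (M : 'M[R]_(m, n)) :
  \tr (M *m M^T) = \sum_i \sum_j M i j ^+ 2.
Proof.
rewrite /mxtrace; apply: eq_bigr => i _; rewrite mxE.
by apply: eq_bigr => j _; rewrite !mxE expr2.
Qed.

Lemma row_eq0_of_gram (R : realDomainType) (n : nat) (u : 'rV[R]_n) :
  \tr (u *m u^T) = 0 -> u = 0.
Proof.
rewrite mxtrace_mul_tr big_ord1 => /sum_sqr_eq0 u0.
by apply/rowP => j; rewrite u0 mxE.
Qed.

(** If P is the orthogonal projection onto the row space of [B], then E = A B
    satisfies E = E P, so tr E is the Frobenius inner product of E and P, and
    |P|_F^2 = tr P = rank B <= t. *)
Lemma mx_trace_sq_le (R : realFieldType) (s t : nat)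
    (A : 'M[R]_(s, t)) (B : 'M[R]_(t, s)) :
  (\tr (A *m B)) ^+ 2 <= t%:R * \sum_i \sum_j (A *m B) i j ^+ 2.
Proof.
have [C Cfree BC] : exists2 C : 'M[R]_(\rank B, s), row_free C & (B <= C)%MS.
  by exists (row_base B); [exact: row_base_free | rewrite eq_row_base].
pose W := C *m C^T.
have Wu : W \in unitmx.
  rewrite -row_free_unit -kermx_eq0; apply/rowV0P => u /sub_kermxP uW.
  have /row_eq0_of_gram uC : \tr ((u *m C) *m (u *m C)^T) = 0.
    by rewrite trmx_mul mulmxA -(mulmxA u) uW mul0mx mxtrace0.
  by apply: (row_free_inj Cfree); rewrite mul0mx.
(* The orthogonal projection onto the row space of B. *)
pose P := C^T *m invmx W *m C.
have symP : P^T = P.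
  rewrite /P !trmx_mul trmxK trmx_inv mulmxA; congr (_ *m invmx _ *m _).
  by rewrite /W trmx_mul trmxK.
have CP : C *m P = C by rewrite /P !mulmxA mulmxV// mul1mx.
have BP : B *m P = B.
  have /submxP[D BD] := BC.
  by rewrite BD -mulmxA CP.
have PP : P *m P = P by rewrite {1}/P -mulmxA CP.
have trP : \tr P = (\rank B)%:R.
  by rewrite /P -mulmxA mxtrace_mulC -mulmxA -/W mulVmx// mxtrace1.
have nP : \sum_k P k.1 k.2 ^+ 2 = (\rank B)%:R.
  rewrite -trP -[in RHS]PP -[X in _ *m X]symP mxtrace_mul_tr.
  by rewrite (pair_bigA _ (fun i j => P i j ^+ 2)).
have : A *m B *m P = A *m B by rewrite -mulmxA BP.
move: (A *m B) => E EP.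
have -> : \tr E = \sum_k E k.1 k.2 * P k.1 k.2.
  rewrite -[in LHS]EP -[X in _ *m X]symP /mxtrace.
  rewrite -(pair_bigA _ (fun i j => E i j * P i j)).
  by apply: eq_bigr => i _; rewrite mxE; apply: eq_bigr => j _; rewrite [P^T _ _]mxE.
apply: (le_trans (cauchy_schwarz_sum _ _)).
rewrite nP mulrC -(pair_bigA _ (fun i j => E i j ^+ 2)) /=.
apply: ler_wpM2r; last by rewrite ler_nat rank_leq_row.
by apply: sumr_ge0 => i _; apply: sumr_ge0 => j _; exact: sqr_ge0.
Qed.

Lemma kernel_trace_sq_le (R : realFieldType) (S T : finType) (F : {set S})
    (P : {set T}) (A : S -> T -> R) (B : T -> S -> R) (E : S -> S -> R) :
  (forall x y, E x y = \sum_(t in P) A x t * B t y) ->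
  (\sum_(x in F) E x x) ^+ 2 <=
  #|P|%:R * \sum_(x in F) \sum_(y in F) E x y ^+ 2.
Proof.
move=> EAB.
pose MA : 'M[R]_(#|F|, #|P|) := \matrix_(i, j) A (enum_val i) (enum_val j).
pose MB : 'M[R]_(#|P|, #|F|) := \matrix_(i, j) B (enum_val i) (enum_val j).
have ME i j : (MA *m MB) i j = E (enum_val i) (enum_val j).
  rewrite mxE EAB [RHS]big_enum_val.
  apply: eq_bigr => k _.
  by rewrite !mxE.
have := mx_trace_sq_le MA MB.
have -> : \tr (MA *m MB) = \sum_(x in F) E x x.
  by rewrite [RHS]big_enum_val /mxtrace; apply: eq_bigr => i _; rewrite ME.
suff -> : \sum_i \sum_j (MA *m MB) i j ^+ 2 =
    \sum_(x in F) \sum_(y in F) E x y ^+ 2 by [].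
rewrite [RHS]big_enum_val; apply: eq_bigr => i _.
by rewrite [RHS]big_enum_val; apply: eq_bigr => j _; rewrite ME.
Qed.

(** * Counting monomials and small sets *)

(** Each small set contributes at least x^b to sum_S x^|S| = (1 + x)^|I|. *)
Lemma card_small_subsets (R : realFieldType) (I : finType) (b : nat) (x : R) :
  0 < x <= 1 ->
  #|[set S : {set I} | (#|S| <= b)%N]|%:R * x ^+ b <= (1 + x) ^+ #|I|.
Proof.
move=> /andP[x0 x1].
have -> : (1 + x) ^+ #|I| = \sum_(S : {set I}) x ^+ #|S|.
  rewrite addrC -prodr_const bigA_distr; apply: eq_bigr => S _.
  by rewrite -big_mkcond /= prodr_const.
rewrite mulr_natl -sumr_const [leRHS](bigID (mem [set S : {set I} | (#|S| <= b)%N])) /=.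
rewrite ler_wpDr//; first by apply: sumr_ge0 => S _; rewrite exprn_ge0// ltW.
apply: ler_sum => S; rewrite inE => Sb.
by apply: ler_wiXn2l => //; exact: ltW.
Qed.

(** The same weighting for monomials: the weights x^|a| of all exponents [a]
    add up to a product of |W| geometric sums. *)
Lemma card_small_exponents (R : realFieldType) (W : finType) (D : nat) (x : R) :
  0 < x < 1 ->
  #|[set a : {ffun W -> 'I_D.+1} | (\sum_w a w <= D)%N]|%:R * x ^+ D
    <= (1 - x)^-1 ^+ #|W|.
Proof.
move=> /andP[x0 x1]; have y0 : 0 < 1 - x by rewrite subr_gt0.
apply: (@le_trans _ _ (\prod_(w : W) \sum_(e < D.+1) x ^+ e)); last first.
  rewrite -prodr_const; apply: ler_prod => w _; apply/andP; split.
    by apply: sumr_ge0 => e _; rewrite exprn_ge0// ltW.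
  rewrite -[leRHS]mul1r ler_pdivlMr//.
  have := subrX1 x D.+1; have : 0 <= x ^+ D.+1 by rewrite exprn_ge0// ltW.
  by lra.
rewrite bigA_distr_bigA /=.
pose T := [set a : {ffun W -> 'I_D.+1} | (\sum_w a w <= D)%N].
rewrite mulr_natl -sumr_const [leRHS](bigID (mem T)) /=.
rewrite ler_wpDr//.
  by apply: sumr_ge0 => a _; apply: prodr_ge0 => w _; rewrite exprn_ge0// ltW.
apply: ler_sum => a; rewrite inE => aD.
by rewrite prodrXr; apply: ler_wiXn2l => //; exact: ltW.
Qed.

(** A product of sums of monomials of degree at most [d] factors through the
    space of polynomials of degree at most d|K|: expand the product over the
    choice functions K -> O and collect those with the same exponent. *)
Lemma prod_sum_monomials (R : comPzRingType) (K O W S : finType) (d : nat)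
    (e : K -> O -> W -> nat) (c : K -> O -> S -> R) (z : W -> S -> R) :
  (forall k o, \sum_w e k o w <= d)%N ->
  exists A : S -> {ffun W -> 'I_(d * #|K|).+1} -> R, forall x y,
    \prod_k \sum_o c k o x * \prod_w z w y ^+ e k o w =
    \sum_(a in [set a : {ffun W -> 'I_(d * #|K|).+1} |
                 (\sum_w a w <= d * #|K|)%N]) A x a * \prod_w z w y ^+ a w.
Proof.
move=> ed.
pose m (h : {ffun K -> O}) : {ffun W -> 'I_(d * #|K|).+1} :=
  [ffun w => inord (\sum_k e k (h k) w)].
have hd (h : {ffun K -> O}) : (\sum_w \sum_k e k (h k) w <= d * #|K|)%N.
  rewrite exchange_big /= mulnC -sum_nat_const.
  by apply: leq_sum => k _; exact: ed.
have mE h w : m h w = \sum_k e k (h k) w :> nat.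
  rewrite ffunE inordK// ltnS; apply: leq_trans (hd h).
  by rewrite [X in (_ <= X)%N](bigD1 w) //= leq_addr.
exists (fun x a => \sum_(h | m h == a) \prod_k c k (h k) x) => x y.
rewrite bigA_distr_bigA /=.
rewrite (partition_big m (mem [set a : {ffun W -> 'I_(d * #|K|).+1} |
                 (\sum_w a w <= d * #|K|)%N])) /=; last first.
  by move=> h _; rewrite inE; under eq_bigr do rewrite mE.
apply: eq_bigr => a _; rewrite mulr_suml; apply: eq_bigr => h /eqP <-.
rewrite big_split /= exchange_big /=; congr (_ * _).
by apply: eq_bigr => w _; rewrite prodrXr mE.
Qed.

Lemma sum_nat_pred1 (W : finType) (w0 : W) : (\sum_w (w == w0) = 1)%N.
Proof. by rewrite (bigD1 w0)//= eqxx big1// => w /negbTE ->. Qed.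

Lemma prodX_pred1 (R : comPzRingType) (W : finType) (z : W -> R) (w0 : W) :
  \prod_w z w ^+ (w == w0) = z w0.
Proof.
rewrite (bigD1 w0)//= eqxx expr1 big1 ?mulr1// => w /negbTE ->.
by rewrite expr0.
Qed.

(** * Sign matrices close to matrices of low rank *)

(** The kernel argument.  The rank of the kernel is bounded by the number of
    monomials in the entries of X and Y; an entry outside [G] contributes the
    factor 1 to the kernel, hence a factor 2 to the sum over all sign matrices. *)
Lemma card_signs_close_on (R : realFieldType) (I J L : finType)
    (G : {set I * J}) (F : {set {ffun I * J -> bool}})
    (X : {ffun I * J -> bool} -> I -> L -> R)
    (Y : {ffun I * J -> bool} -> L -> J -> R) :
  (forall V, V \in F -> forall k, k \in G ->
    `|\sum_l X V k.1 l * Y V l k.2 - (-1) ^+ V k| <= 1 / 20) ->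
  #|F|%:R <= (#|[set a : {ffun (I * L) + (L * J) -> 'I_(2 * #|{: I * J}|).+1} |
               (\sum_w a w <= 2 * #|{: I * J}|)%N]|%:R
             * 2 ^+ #|~: G|) * (111 / 100) ^+ #|G| :> R.
Proof.
set T := [set a | _] => close.
pose b V (k : I * J) := \sum_l X V k.1 l * Y V l k.2.
pose E (U V : {ffun I * J -> bool}) : R :=
  \prod_k (if k \in G then 1 + (-1) ^+ U k * b V k else 1).
(* The factor 1 + U_k (X Y)_k as a sum of monomials: [inl l] stands for the
   term U_k X_il Y_lj and [inr tt] for the term 1. *)
pose c (k : I * J) (o : L + unit) (U : {ffun I * J -> bool}) : R :=
  match o with
  | inl l => if k \in G then (-1) ^+ U k else 0
  | inr _ => 1
  end.
pose e (k : I * J) (o : L + unit) (w : (I * L) + (L * J)) : nat :=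
  match o with
  | inl l => ((w == inl (k.1, l)) + (w == inr (l, k.2)))%N
  | inr _ => 0%N
  end.
pose z (w : (I * L) + (L * J)) (V : {ffun I * J -> bool}) : R :=
  match w with inl (i, l) => X V i l | inr (l, j) => Y V l j end.
have e2 k o : (\sum_w e k o w <= 2)%N.
  case: o => [l|u] /=; last by rewrite big1.
  by rewrite big_split /= !sum_nat_pred1.
have [A EA] := prod_sum_monomials c z e2.
have {}EA U V : E U V = \sum_(a in T) A U a * \prod_w z w V ^+ a w.
  rewrite -EA; apply: eq_bigr => k _; rewrite big_sumType /=.
  rewrite [X in _ = _ + X](big_pred1 tt) /=; last by case.
  rewrite [X in _ + 1 * X]big1 ?mulr1; last by move=> w _; rewrite expr0.
  under eq_bigr => l _.
    under eq_bigr do rewrite exprD.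
    rewrite big_split /= !prodX_pred1 /=.
    over.
  rewrite -mulr_sumr [RHS]addrC.
  by case: ifP => // _; rewrite mul0r addr0.
have := kernel_trace_sq_le F EA.
set tr := \sum_(V in F) E V V => trE.
(* On the diagonal V_k b_k is at least 19/20. *)
have trge : #|F|%:R * (195 / 100) ^+ #|G| <= tr.
  rewrite mulr_natl -sumr_const; apply: ler_sum => V VF.
  rewrite -prodr_const big_mkcond /= /E; apply: ler_prod => k _.
  case: ifP => kG; last by rewrite ler01 lexx.
  have := close V VF k kG; rewrite -/(b V k) ler_norml.
  by case: (V k) => /=; rewrite ?expr1 ?expr0 => /andP[? ?]; apply/andP; split; lra.
(* Enlarging the sum over U in F to all sign matrices makes it a product of
   the sums (1 + b_k)^2 + (1 - b_k)^2 <= 2 + 2 (21/20)^2. *)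
have frob : \sum_(U in F) \sum_(V in F) E U V ^+ 2 <=
    #|F|%:R * ((421 / 100) ^+ #|G| * 2 ^+ #|~: G|).
  rewrite exchange_big /= mulr_natl -sumr_const; apply: ler_sum => V VF.
  apply: (@le_trans _ _ (\sum_U E U V ^+ 2)).
    rewrite [leRHS](bigID (mem F)) /= ler_wpDr//.
    by apply: sumr_ge0 => U _; exact: sqr_ge0.
  under eq_bigr do rewrite /E -prodrXl.
  rewrite -(bigA_distr_bigA (fun k s =>
     (if k \in G then 1 + (-1) ^+ (s : bool) * b V k else 1) ^+ 2)) /=.
  rewrite (bigID (mem G)) /= -[#|~: G|]/#|mem (~: G)| -!prodr_const.
  rewrite [X in _ <= _ * X](eq_bigl (fun k => k \notin G)); last first.
    by move=> k; rewrite inE.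
  apply: ler_pM.
  - by apply: prodr_ge0 => k _; apply: sumr_ge0 => s _; exact: sqr_ge0.
  - by apply: prodr_ge0 => k _; apply: sumr_ge0 => s _; exact: sqr_ge0.
  - apply: ler_prod => k kG; rewrite big_bool /= kG expr1 expr0.
    rewrite addr_ge0 ?sqr_ge0//=.
    have := close V VF k kG; rewrite -/(b V k) ler_norml.
    by case: (V k) => /=; rewrite ?expr1 ?expr0 => /andP[? ?]; nra.
  - apply: ler_prod => k /negbTE kG; rewrite big_bool /= kG expr1n.
    by apply/andP; split; lra.
have [->|F0] := eqVneq #|F| 0%N.
  by rewrite mulr_ge0 ?mulr_ge0// ?exprn_ge0//; lra.
have Fp : 0 < #|F|%:R :> R by rewrite ltr0n lt0n.
have H : (#|F|%:R * (195 / 100) ^+ #|G|) ^+ 2 <=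
   #|T|%:R * (#|F|%:R * ((421 / 100) ^+ #|G| * 2 ^+ #|~: G|)) :> R.
  apply: le_trans (le_trans trE _); last by rewrite ler_wpM2l.
  rewrite lerXn2r// nnegrE; last by apply: le_trans trge; rewrite mulr_ge0 ?exprn_ge0//; lra.
  by rewrite mulr_ge0// exprn_ge0//; lra.
have {}H : #|F|%:R * ((195 / 100) ^+ 2) ^+ #|G| <=
   #|T|%:R * 2 ^+ #|~: G| * (421 / 100) ^+ #|G| :> R.
  rewrite -(ler_pM2l Fp); apply: le_trans (le_trans H _).
    by rewrite [leRHS]exprMn [(_ ^+ #|G|) ^+ 2]exprAC [#|F|%:R ^+ 2]expr2 mulrA.
  by rewrite le_eqVlt; apply/orP; left; apply/eqP; ring.
have q0 : 0 < ((195 / 100) ^+ 2) ^+ #|G| :> R by rewrite exprn_gt0//; lra.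
(* 4.21 <= 1.11 * 1.95^2 *)
rewrite -(ler_pM2r q0); apply: (le_trans H).
rewrite -[leRHS]mulrA -exprMn; apply: ler_wpM2l.
  by apply: mulr_ge0; [exact: ler0n|exact: exprn_ge0].
by apply: lerXn2r; rewrite ?nnegrE; lra.
Qed.

(** Bernoulli gives 2 <= 1.01^100, so 101 <= 2^7 <= 1.01^700. *)
Lemma pow_101_le (R : realFieldType) (m M : nat) :
  (700 * m <= M)%N -> 101 ^+ m <= (101 / 100) ^+ M :> R.
Proof.
move=> mM.
have bern (n : nat) : 1 + n%:R / 100 <= (101 / 100) ^+ n :> R.
  elim: n => [|n IH]; first by rewrite mul0r addr0 expr0.
  have n0 : 0 <= n%:R :> R by exact: ler0n.
  by rewrite exprS -natr1; nra.
have two : 2 <= (101 / 100) ^+ 100 :> R by apply: le_trans (bern 100%N); lra.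
have h : 101 <= (101 / 100) ^+ 700 :> R.
  rewrite -[700%N]/(100 * 7)%N exprM.
  apply: (@le_trans _ _ (2 ^+ 7)); first by lra.
  by apply: lerXn2r; rewrite ?nnegrE ?exprn_ge0//; lra.
apply: (@le_trans _ _ ((101 / 100) ^+ (700 * m))).
  by rewrite exprM; apply: lerXn2r; rewrite ?nnegrE ?exprn_ge0//; lra.
by apply: ler_weXn2l => //; lra.
Qed.

Lemma low_rank_factor (F : fieldType) (p q n : nat) (B : 'M[F]_(p, q)) :
  (\rank B <= n)%N ->
  exists X : 'M[F]_(p, n), exists Y : 'M[F]_(n, q), B = X *m Y.
Proof.
move=> Bn.
exists (col_base B *m pid_mx (\rank B)), (pid_mx (\rank B) *m row_base B).
rewrite mulmxA -(mulmxA (col_base B)) mul_pid_mx minnn (minn_idPr Bn).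
by rewrite pid_mx_1 mulmx1 mulmx_base.
Qed.

(** Sum the bound for a fixed good set over the complements of sets of at most
    pq/700 bad entries.  With M = pq, the number of bad sets is at most 1.01^(2M),
    the number of monomials at most 1.01^(3M), and the free entries give
    2^(M/700) <= 1.01^M; finally 1.01^6 * 1.11 < 6/5. *)
Lemma card_signs_near_low_rank (R : realFieldType) (p q n : nat)
    (F : {set {ffun 'I_p * 'I_q -> bool}}) :
  (700 * (n * (p + q)) <= p * q)%N ->
  (forall V, V \in F -> exists2 B : 'M[R]_(p, q), (\rank B <= n)%N &
     (700 * #|[set k | (1 / 20 < `|B k.1 k.2 - (-1) ^+ V k|)%R]| <= p * q)%N) ->
  #|F|%:R <= (6 / 5) ^+ (p * q) :> R.
Proof.
move=> nM close; set M := (p * q)%N.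
have {}close (V : {ffun 'I_p * 'I_q -> bool}) :
    exists B : 'M[R]_(p, n) * 'M[R]_(n, q), V \in F ->
     (700 * #|[set k | (1 / 20 < `|(B.1 *m B.2) k.1 k.2 - (-1) ^+ V k|)%R]| <= M)%N.
  have [VF|] := boolP (V \in F); last by exists (0, 0).
  have [B Bn BV] := close V VF.
  by have [X [Y BXY]] := low_rank_factor Bn; exists (X, Y); rewrite -BXY.
have [B BP] := boolp.choice close.
pose bad (V : {ffun 'I_p * 'I_q -> bool}) :=
  [set k | 1 / 20 < `|((B V).1 *m (B V).2) k.1 k.2 - (-1) ^+ V k|].
pose b := (M %/ 700)%N.
have bM : (700 * b <= M)%N by rewrite mulnC leq_divM.
have badb V : V \in F -> (#|bad V| <= b)%N.
  by move=> /BP H; rewrite leq_divRL// mulnC.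
pose D := #|[set S : {set 'I_p * 'I_q} | (#|S| <= b)%N]|.
have KE : #|{: 'I_p * 'I_q}| = M by rewrite card_prod !card_ord.
pose t := #|[set a : {ffun ('I_p * 'I_n) + ('I_n * 'I_q) -> 'I_(2 * M).+1} |
               (\sum_w a w <= 2 * M)%N]|.
have FS (S : {set 'I_p * 'I_q}) : (#|S| <= b)%N ->
    #|[set V in F | bad V == S]|%:R <= t%:R * 2 ^+ b * (111 / 100) ^+ M :> R.
  move=> Sb.
  have := @card_signs_close_on R 'I_p 'I_q 'I_n (~: S) [set V in F | bad V == S]
    (fun V i l => (B V).1 i l) (fun V l j => (B V).2 l j).
  rewrite KE -/t finset.setCK => H; apply: le_trans (H _) _.
    move=> V; rewrite inE => /andP[VF /eqP <-] k; rewrite !inE -leNgt.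
    by rewrite mxE.
  apply: ler_pM.
  - by apply: mulr_ge0; [exact: ler0n|exact: exprn_ge0].
  - by apply: exprn_ge0; lra.
  - by apply: ler_wpM2l; [exact: ler0n|apply: ler_weXn2l => //; lra].
  apply: ler_weXn2l; first by lra.
  by rewrite -KE -cardsT subset_leq_card// finset.subsetT.
have FD : #|F|%:R <= D%:R * (t%:R * 2 ^+ b * (111 / 100) ^+ M) :> R.
  rewrite mulr_natl -sumr_const -sumr_const.
  rewrite (partition_big bad (mem [set S : {set 'I_p * 'I_q} | (#|S| <= b)%N])) /=.
    apply: ler_sum => S; rewrite inE => /FS; apply: le_trans.
    by rewrite -sumr_const; under [leRHS]eq_bigl do rewrite inE.
  by move=> V /badb; rewrite inE.
pose g : R := 101 / 100.
have g0 : 0 <= g by rewrite /g; lra.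
(* Weights x = 1/100 for the bad sets and x = 100/101 for the monomials. *)
have DM : D%:R <= g ^+ M * g ^+ M.
  have x01 : (0 < 1 / 100 :> R) && (1 / 100 <= 1 :> R) by apply/andP; split; lra.
  have := @card_small_subsets R ('I_p * 'I_q)%type b _ x01.
  rewrite -/D KE.
  rewrite (_ : 1 + 1 / 100 = g); last by rewrite /g; lra.
  move=> H.
  have h : 100 ^+ b <= g ^+ M.
    apply: le_trans (pow_101_le R bM).
    by apply: lerXn2r; rewrite ?nnegrE; lra.
  have h0 : 0 < 100 ^+ b :> R by rewrite exprn_gt0//; lra.
  apply: (@le_trans _ _ (g ^+ M * 100 ^+ b)); last by rewrite ler_wpM2l// exprn_ge0.
  by rewrite -ler_pdivrMr// -exprVn -div1r.
have tM : t%:R <= g ^+ M * g ^+ M * g ^+ M.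
  have x01 : (0 < 100 / 101 :> R) && (100 / 101 < 1 :> R).
    by apply/andP; split; lra.
  have := @card_small_exponents R (('I_p * 'I_n) + ('I_n * 'I_q))%type (2 * M) _ x01.
  rewrite -/t.
  rewrite card_sum !card_prod !card_ord.
  rewrite (_ : 1 - 100 / 101 = 101^-1) ?invrK; last by lra.
  have := @pow_101_le R (p * n + n * q) M.
  rewrite (mulnC p) -mulnDr => /(_ nM) h /le_trans/(_ h).
  rewrite -ler_pdivlMr; last by rewrite exprn_gt0//; lra.
  move=> /le_trans; apply.
  rewrite -exprVn invf_div -/g.
  by rewrite mul2n -addnn exprD mulrA.
have bM2 : 2 ^+ b <= g ^+ M.
  apply: le_trans (pow_101_le R bM).
  by apply: lerXn2r; rewrite ?nnegrE; lra.
apply: (le_trans FD).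
apply: (@le_trans _ _ ((g ^+ M * g ^+ M) * ((g ^+ M * g ^+ M * g ^+ M) * g ^+ M * (111 / 100) ^+ M))).
  have ? : 0 <= 2 ^+ b :> R by rewrite exprn_ge0.
  have ? : 0 <= (111 / 100) ^+ M :> R by rewrite exprn_ge0//; lra.
  apply: ler_pM; rewrite ?mulr_ge0//.
  apply: ler_pM; rewrite ?mulr_ge0//.
  by apply: ler_pM.
rewrite -!exprMn; apply: lerXn2r; rewrite ?nnegrE /g; lra.
Qed.

(** * Orthonormal rows close to sign vectors *)

Lemma sum_sign_mul (R : realDomainType) (N : nat) (j l : 'I_N) :
  \sum_(v : {ffun 'I_N -> bool}) (-1) ^+ v j * (-1) ^+ v l = (2 ^ N)%:R * (j == l)%:R :> R.
Proof.
have [->|jl] := eqVneq j l.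
  under eq_bigr do rewrite -expr2 sqrr_sign.
  by rewrite sumr_const card_ffun card_bool card_ord mulr1.
pose flip (v : {ffun 'I_N -> bool}) : {ffun 'I_N -> bool} := [ffun i => v i (+) (i == j)].
have flipK : involutive flip.
  by move=> v; apply/ffunP => i; rewrite !ffunE -addbA addbb addbF.
rewrite mulr0; set S := \sum_(v : {ffun 'I_N -> bool}) _.
suff SN : S = - S by lra.
rewrite {1}/S (reindex_inj (inv_inj flipK)) -sumrN; apply: eq_bigr => v _.
by rewrite !ffunE eqxx eq_sym (negbTE jl) addbF addbT signrN mulNr.
Qed.

Lemma sum_sign_form (R : realDomainType) (N : nat) (a : 'I_N -> R) :
  \sum_(v : {ffun 'I_N -> bool}) (\sum_j (-1) ^+ v j * a j) ^+ 2 = (2 ^ N)%:R * \sum_j a j ^+ 2.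
Proof.
transitivity (\sum_j \sum_l (a j * a l) *
    \sum_(v : {ffun 'I_N -> bool}) ((-1) ^+ v j * (-1) ^+ v l) : R).
  under eq_bigr => v _.
    rewrite expr2 mulr_suml.
    under eq_bigr do rewrite mulr_sumr.
    over.
  rewrite exchange_big; apply: eq_bigr => j _ /=.
  rewrite exchange_big; apply: eq_bigr => l _ /=.
  by rewrite mulr_sumr; apply: eq_bigr => v _; ring.
rewrite mulr_sumr; apply: eq_bigr => j _.
rewrite (bigD1 j)//= [X in _ + X = _]big1 => [|l lj]; first by rewrite sum_sign_mul eqxx mulr1 addr0 mulrC expr2.
by rewrite sum_sign_mul eq_sym (negbTE lj) !mulr0.
Qed.

Definition sign_row (R : rcfType) (N : nat) (v : {ffun 'I_N -> bool}) : 'rV[R]_N := \row_j (-1) ^+ v j.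

(** The squared norm of the projection of [x] onto the span of the rows of [Phi],
    when these are orthonormal. *)
Definition proj_energy (R : rcfType) (N k : nat) (Phi : 'M[R]_(k, N)) (x : 'rV[R]_N) : R :=
  \sum_i (x *m Phi^T) 0 i ^+ 2.

(** The coordinates of a random sign vector are uncorrelated, so the mean of the
    energy is the trace of the projection. *)
Lemma sum_proj_energy (R : rcfType) (N k : nat) (Phi : 'M[R]_(k, N)) :
  Phi *m Phi^T = 1%:M ->
  \sum_(v : {ffun 'I_N -> bool}) proj_energy Phi (sign_row R v) = (2 ^ N)%:R * k%:R.
Proof.
move=> Phi1; rewrite exchange_big /=.
under eq_bigr => i _.
  under eq_bigr => v _.
    rewrite mxE.
    under eq_bigr do rewrite !mxE.
    over.
  rewrite sum_sign_form.
  over.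
rewrite -mulr_sumr; congr (_ * _).
by rewrite -mxtrace_mul_tr Phi1 mxtrace1.
Qed.

(** Markov's inequality; when k = 0 the energy vanishes identically. *)
Lemma card_low_energy (R : rcfType) (N k : nat) (Phi : 'M[R]_(k, N)) :
  Phi *m Phi^T = 1%:M ->
  3 / 4 * 2 ^+ N <=
  #|[set v : {ffun 'I_N -> bool} | proj_energy Phi (sign_row R v) <= 4 * k%:R]|%:R :> R.
Proof.
move=> Phi1; set A := [set v | _].
have cAC : #|A|%:R + #|~: A|%:R = 2 ^+ N :> R.
  by rewrite -natrD cardsC card_ffun card_bool card_ord natrX.
have e0 (v : {ffun 'I_N -> bool}) : 0 <= proj_energy Phi (sign_row R v).
  by apply: sumr_ge0 => i _; exact: sqr_ge0.
have H : #|~: A|%:R * (4 * k%:R) <= 2 ^+ N * k%:R :> R.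
  rewrite -[2 ^+ N]natrX -(sum_proj_energy Phi1) mulr_natl -sumr_const.
  rewrite [leRHS](bigID (mem (~: A))) /= ler_wpDr//; first exact: sumr_ge0.
  by apply: ler_sum => v; rewrite !inE -ltNge => /ltW.
have [k0|kp] := posnP k; last first.
  have kR : 0 < k%:R :> R by rewrite ltr0n.
  have : #|~: A|%:R * 4 <= 2 ^+ N :> R by rewrite -(ler_pM2r kR) -mulrA.
  by lra.
suff -> : A = [set: {ffun 'I_N -> bool}].
  rewrite cardsT card_ffun card_bool card_ord natrX.
  have ? : 0 <= (2 : R) ^+ N by rewrite exprn_ge0.
  by lra.
apply/finset.setP => v; rewrite !inE /proj_energy big1 ?mulr_ge0// => i _.
by exfalso; case: i; rewrite k0.
Qed.

(** Take for [w] the normalization of the component u of [x] orthogonal to the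
    rows of [Phi].  Since <x, u> = |u|^2 = N - e, with e the energy, the squared
    distance is 2N - 2 sqrt(N (N - e)) <= 2e. *)
Lemma gram_schmidt_step (R : rcfType) (N k : nat) (Phi : 'M[R]_(k, N)) (x : 'rV[R]_N) :
  Phi *m Phi^T = 1%:M -> \sum_j x 0 j ^+ 2 = N%:R ->
  proj_energy Phi x < N%:R ->
  exists2 w : 'rV[R]_N,
    col_mx w Phi *m (col_mx w Phi)^T = 1%:M &
    \sum_j (Num.sqrt N%:R * w 0 j - x 0 j) ^+ 2 <= 2 * proj_energy Phi x.
Proof.
move=> Phi1 xN eN; set e := proj_energy Phi x.
pose u := x - x *m Phi^T *m Phi.
have uPhi : u *m Phi^T = 0 by rewrite mulmxBl -!mulmxA Phi1 mulmx1 subrr.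
pose d := N%:R - e.
have dp : 0 < d by rewrite subr_gt0.
have sq_mx (y : 'rV[R]_N) : y *m y^T = (\sum_j y 0 j ^+ 2)%:M.
  by rewrite [LHS]mx11_scalar mxE; congr _%:M; apply: eq_bigr => j _; rewrite mxE expr2.
have sqk_mx (y : 'rV[R]_k) : y *m y^T = (\sum_j y 0 j ^+ 2)%:M.
  by rewrite [LHS]mx11_scalar mxE; congr _%:M; apply: eq_bigr => j _; rewrite mxE expr2.
have xu : x *m u^T = d%:M.
  rewrite /u linearB /= mulmxBr sq_mx xN trmx_mul mulmxA sqk_mx -/e.
  by rewrite -raddfB.
have uu : u *m u^T = d%:M.
  by rewrite {1}/u mulmxBl -(mulmxA _ Phi) -[Phi]trmxK -trmx_mul trmxK uPhi trmx0 mulmx0 subr0.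
pose r := Num.sqrt d.
have rp : 0 < r by rewrite sqrtr_gt0.
have r2 : r ^+ 2 = d by rewrite sqr_sqrtr// ltW.
pose w := r^-1 *: u.
have ww : w *m w^T = 1%:M.
  rewrite linearZ /= -scalemxAr -scalemxAl uu !scale_scalar_mx -r2.
  by congr _%:M; field; rewrite gt_eqF.
have xw : x *m w^T = r%:M.
  rewrite linearZ /= -scalemxAr xu scale_scalar_mx -r2.
  by congr _%:M; field; rewrite gt_eqF.
exists w.
  rewrite tr_col_mx mul_col_row Phi1 ww -scalemxAl uPhi scaler0.
  rewrite -[Phi *m _]trmxK trmx_mul trmxK -scalemxAl uPhi scaler0 trmx0.
  by rewrite -scalar_mx_block.
have wj : \sum_j w 0 j ^+ 2 = 1.
  by have := congr1 (fun M : 'M[R]_1 => M 0 0) ww; rewrite sq_mx ![_%:M _ _]mxE eqxx !mulr1n.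
have xwj : \sum_j x 0 j * w 0 j = r.
  have := congr1 (fun M : 'M[R]_1 => M 0 0) xw; rewrite !mxE eqxx mulr1n => <-.
  by apply: eq_bigr => j _; rewrite [_^T _ _]mxE.
pose s := Num.sqrt (N%:R : R).
have s2 : s ^+ 2 = N%:R by rewrite sqr_sqrtr.
have -> : \sum_j (s * w 0 j - x 0 j) ^+ 2 =
   s ^+ 2 * \sum_j w 0 j ^+ 2 - 2 * s * (\sum_j x 0 j * w 0 j) + \sum_j x 0 j ^+ 2.
  rewrite !mulr_sumr -sumrB -big_split /=; apply: eq_bigr => j _; ring.
rewrite wj xwj xN mulr1 -s2.
have e0 : 0 <= e by apply: sumr_ge0 => i _; exact: sqr_ge0.
have rs : r <= s by rewrite ler_sqrt// /d gerBl.
have -> : e = s ^+ 2 - r ^+ 2 by rewrite s2 r2 /d; ring.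
by nra.
Qed.

(** Rows are added one at a time by the Gram-Schmidt step: the mean energy of a
    sign vector is the number of rows, so some sign vector is outside the span. *)
Lemma orthonormal_completion (R : rcfType) (N p : nat) (Phi : 'M[R]_(p, N)) :
  Phi *m Phi^T = 1%:M -> (p <= N)%N ->
  exists2 Psi : 'M[R]_N, Psi *m Psi^T = 1%:M &
    exists2 f : 'I_p -> 'I_N, injective f & forall i j, Psi (f i) j = Phi i j.
Proof.
move=> Phi1 pN.
have : forall d, (d + p <= N)%N -> exists2 Psi : 'M[R]_(d + p, N),
    Psi *m Psi^T = 1%:M & forall i j, Psi (rshift d i) j = Phi i j.
  elim=> [_|d IH dpN].
    by exists Phi => // i j; congr (Phi _ _); exact: val_inj.
  have [Psi Psi1 PsiPhi] := IH (ltnW dpN).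
  have [v vN] : exists v : {ffun 'I_N -> bool},
      proj_energy Psi (sign_row R v) < N%:R.
    apply: contrapT => /forallNP H.
    have : (2 ^ N)%:R * N%:R <= (2 ^ N)%:R * (d + p)%:R :> R.
      rewrite -(sum_proj_energy Psi1) mulr_natl.
      have -> : (2 ^ N = #|{: {ffun 'I_N -> bool}}|)%N.
        by rewrite card_ffun card_bool card_ord.
      rewrite -sumr_const; apply: ler_sum => v _.
      by rewrite leNgt; exact/negP.
    rewrite ler_pM2l ?ltr0n ?expn_gt0// ler_nat leqNgt.
    by rewrite (leq_trans _ dpN).
  have sN : \sum_j sign_row R v 0 j ^+ 2 = N%:R.
    under eq_bigr do rewrite mxE sqrr_sign.
    by rewrite sumr_const card_ord.
  have [w w1 _] := gram_schmidt_step Psi1 sN vN.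
  exists (col_mx w Psi : 'M[R]_(d.+1 + p, N)) => // i j.
  rewrite -PsiPhi -(col_mxEd w Psi); congr (col_mx w Psi _ _).
  exact: val_inj.
have E : (N - p + p)%N = N by rewrite subnK.
move=> /(_ (N - p)%N); rewrite {1}E => /(_ (leqnn N))[Psi Psi1 PsiPhi].
exists (\matrix_(i, j) Psi (cast_ord (esym E) i) j).
  apply/matrixP => i i'; rewrite !mxE.
  transitivity ((Psi *m Psi^T) (cast_ord (esym E) i) (cast_ord (esym E) i')).
    by rewrite mxE; apply: eq_bigr => j _; rewrite !mxE.
  by rewrite Psi1 mxE (inj_eq (@cast_ord_inj _ _ _)).
exists (fun i => cast_ord E (rshift (N - p) i)).
  by move=> i i' /cast_ord_inj /rshift_inj.
by move=> i j; rewrite mxE cast_ordK PsiPhi.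
Qed.

(** Here 1/K is the proportion gamma of the number of rows to [N], and the total
    deviation allowed is the one that k Gram-Schmidt steps produce when K k <= N. *)
Definition near_orthonormal (R : rcfType) (N K k : nat)
    (s : k.-tuple {ffun 'I_N -> bool}) : Prop :=
  exists2 Phi : 'M[R]_(k, N), Phi *m Phi^T = 1%:M &
    K%:R * (\sum_i \sum_j (Num.sqrt N%:R * Phi i j - (-1) ^+ tnth s i j) ^+ 2)
      <= 8 * N%:R * k%:R.

(** A new row adds at most 2 * 4k <= 8N/K to the total squared deviation. *)
Lemma near_orthonormal_cons (R : rcfType) (N K k : nat)
    (s : k.-tuple {ffun 'I_N -> bool}) :
  (0 < N)%N -> (5 <= K)%N -> (K * k <= N)%N ->
  near_orthonormal R K s ->
  exists2 A : {set {ffun 'I_N -> bool}}, 3 / 4 * 2 ^+ N <= #|A|%:R :> R &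
    forall v, v \in A -> near_orthonormal R K (cons_tuple v s).
Proof.
move=> N0 K5 kN [Phi Phi1 Phis].
exists [set v | proj_energy Phi (sign_row R v) <= 4 * k%:R].
  exact: card_low_energy.
move=> v; rewrite inE => ev.
have kN' : (4 * k < N)%N by nia.
have sN : \sum_j sign_row R v 0 j ^+ 2 = N%:R.
  under eq_bigr do rewrite mxE sqrr_sign.
  by rewrite sumr_const card_ord.
have eN : proj_energy Phi (sign_row R v) < N%:R.
  by apply: (le_lt_trans ev); rewrite -natrM ltr_nat.
have [w w1 wv] := gram_schmidt_step Phi1 sN eN.
exists (col_mx w Phi : 'M[R]_(k.+1, N)) => //.
rewrite big_ord_recl.
have -> : \sum_j (Num.sqrt N%:R * (col_mx w Phi : 'M[R]_(k.+1, N)) ord0 j -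
    (-1) ^+ tnth (cons_tuple v s) ord0 j) ^+ 2 =
    \sum_j (Num.sqrt N%:R * w 0 j - sign_row R v 0 j) ^+ 2.
  apply: eq_bigr => j _; rewrite tnth0 [sign_row _ _ _ _]mxE -(col_mxEu w Phi).
  by congr ((_ * col_mx w Phi _ _ - _) ^+ 2); exact: val_inj.
have -> : \sum_(i < k) \sum_j (Num.sqrt N%:R *
    (col_mx w Phi : 'M[R]_(k.+1, N)) (lift ord0 i) j -
    (-1) ^+ tnth (cons_tuple v s) (lift ord0 i) j) ^+ 2 =
    \sum_i \sum_j (Num.sqrt N%:R * Phi i j - (-1) ^+ tnth s i j) ^+ 2.
  apply: eq_bigr => i _; apply: eq_bigr => j _.
  rewrite tnthS -(col_mxEd w Phi).
  by congr ((_ * col_mx w Phi _ _ - _) ^+ 2); exact: val_inj.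
rewrite mulrDr -[k.+1%:R]natr1 mulrDr [leRHS]addrC lerD// mulr1.
have {}wv := le_trans wv (ler_wpM2l _ ev).
have KkN : K%:R * k%:R <= N%:R :> R by rewrite -natrM ler_nat.
apply: le_trans (ler_wpM2l _ (wv _)) _ => //.
by rewrite (_ : _ * _ = 8 * (K%:R * k%:R)) ?ler_wpM2l//; ring.
Qed.

(** The pairs (good tuple, good new row) inject into the longer good tuples. *)
Lemma card_near_orthonormal (R : rcfType) (N K k : nat) :
  (0 < N)%N -> (5 <= K)%N -> (K * k.-1 <= N)%N ->
  (3 / 4 * 2 ^+ N) ^+ k <=
  #|[set s : k.-tuple {ffun 'I_N -> bool} | `[< near_orthonormal R K s >]]|%:R :> R.
Proof.
move=> N0 K5; elim: k => [_|k IH /= kN].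
  rewrite expr0 (ler_nat _ 1%N) card_gt0; apply/set0Pn; exists [tuple].
  rewrite inE; apply/asboolP; exists 0; last by rewrite big_ord0 !mulr0.
  by apply/matrixP => -[].
have {}IH := IH (leq_trans (leq_mul (leqnn K) (leq_pred k)) kN).
set S := [set s | _] in IH; set T := [set s | _].
have ext (s : k.-tuple {ffun 'I_N -> bool}) : exists A : {set {ffun 'I_N -> bool}},
    s \in S -> 3 / 4 * 2 ^+ N <= #|A|%:R :> R /\
    forall v, v \in A -> near_orthonormal R K (cons_tuple v s).
  have [sS|_] := boolP (s \in S); last by exists finset.set0.
  move: (sS); rewrite inE => /asboolP/(near_orthonormal_cons N0 K5 kN)[A A1 A2].
  by exists A.
have [A AP] := boolp.choice ext.
pose D := [set x : k.-tuple {ffun 'I_N -> bool} * {ffun 'I_N -> bool} |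
  (x.1 \in S) && (x.2 \in A x.1)].
pose c (x : k.-tuple {ffun 'I_N -> bool} * {ffun 'I_N -> bool}) :
  k.+1.-tuple {ffun 'I_N -> bool} := cons_tuple x.2 x.1.
have cI : injective c.
  move=> [s v] [s' v'] /(congr1 val) /= [-> E].
  by congr (_, _); exact: val_inj.
have DT : (#|D| <= #|T|)%N.
  rewrite -(card_imset _ cI) subset_leq_card//.
  apply/fintype.subsetP => y /imsetP[[s v]]; rewrite inE /= => /andP[sS vA] ->.
  by rewrite inE; apply/asboolP; exact: (AP s sS).2.
have DE : #|D|%:R = \sum_(s in S) #|A s|%:R :> R.
  rewrite -natr_sum; congr _%:R; rewrite -sum1_card.
  under [RHS]eq_bigr do rewrite -sum1_card.
  by rewrite pair_big_dep /=; apply: eq_bigl => x; rewrite inE.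
apply: (@le_trans _ _ #|D|%:R); last by rewrite ler_nat.
rewrite DE; apply: (@le_trans _ _ (\sum_(s in S) (3 / 4 * 2 ^+ N))).
  rewrite sumr_const -[_ *+ #|S|]mulr_natl exprSr.
  by apply: ler_wpM2r IH; apply: mulr_ge0; [lra|exact: exprn_ge0].
by apply: ler_sum => s sS; exact: (AP s sS).1.
Qed.

(** By counting, some nearly orthonormal tuple of sign vectors is far from all
    matrices of rank at most [n]: (3/4 * 2^N)^p >= (3/2)^(pN) > (6/5)^(pN).  By
    Chebyshev its distance to sqrt(N) Phi exceeds 1/40 at few entries, so
    sqrt(N) Phi is far from these matrices as well. *)
Lemma rigid_orthonormal_rows (R : rcfType) (N K p n : nat) :
  (0 < N)%N -> (0 < p)%N -> 100 ^+ 4 <= K%:R :> R -> (K * p.-1 <= N)%N ->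
  (700 * (n * (p + N)) <= p * N)%N ->
  exists2 Phi : 'M[R]_(p, N), Phi *m Phi^T = 1%:M &
    forall B : 'M[R]_(p, N), (\rank B <= n)%N ->
      (p * N < 1400 *
        #|[set k | (1 / 40 < `|B k.1 k.2 - Num.sqrt N%:R * Phi k.1 k.2|)%R]|)%N.
Proof.
move=> N0 p0 KR KpN npN.
have K5 : (5 <= K)%N.
  by rewrite -(ler_nat R); apply: le_trans KR; lra.
have := card_near_orthonormal R N0 K5 KpN.
set S := [set s | _] => cS.
pose code (s : p.-tuple {ffun 'I_N -> bool}) : {ffun 'I_p * 'I_N -> bool} :=
  [ffun k => tnth s k.1 k.2].
have codeI : injective code.
  move=> s s' /ffunP E; apply: eq_from_tnth => i; apply/ffunP => j.
  by have := E (i, j); rewrite !ffunE.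
pose approx (V : {ffun 'I_p * 'I_N -> bool}) := exists2 B : 'M[R]_(p, N), (\rank B <= n)%N &
     (700 * #|[set k | (1 / 20 < `|B k.1 k.2 - (-1) ^+ V k|)%R]| <= p * N)%N.
have [s sS sF] : exists2 s, s \in S & ~ approx (code s).
  apply: contrapT => H.
  have : #|code @: S|%:R <= (6 / 5) ^+ (p * N) :> R.
    apply: (card_signs_near_low_rank npN) => _ /imsetP[s sS ->].
    by apply: contrapT => H'; apply: H; exists s.
  rewrite (card_imset _ codeI) => /(le_trans cS); apply/negP; rewrite -ltNge.
  apply: (@lt_le_trans _ _ ((3 / 2) ^+ (p * N))).
    have [h1 h2] : 0 <= 6 / 5 :> R /\ 6 / 5 < 3 / 2 :> R by split; lra.
    by rewrite ltrXn2r// -lt0n muln_gt0 p0 N0.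
  rewrite mulnC exprM; apply: lerXn2r; rewrite ?nnegrE.
  - by apply: exprn_ge0; lra.
  - by apply: mulr_ge0; [lra|exact: exprn_ge0].
  rewrite [X in X ^+ _](_ : _ = 3 / 4 * 2); last by lra.
  rewrite exprMn ler_wpM2r ?exprn_ge0//.
  by apply: ler_iXnr => //; lra.
move: sS; rewrite inE => /asboolP[Phi Phi1 Phis].
exists Phi => // B Bn.
rewrite ltnNge; apply/negP => Bclose; apply: sF; exists B => //.
set b0 := [set k | _]; set b1 := [set k | _] in Bclose.
pose b2 := [set k : 'I_p * 'I_N | 1 / 40 < `|Num.sqrt N%:R * Phi k.1 k.2 - (-1) ^+ code s k|].
have bU : (#|b0| <= #|b1| + #|b2|)%N.
  apply: leq_trans (leq_card_setU _ _); apply: subset_leq_card.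
  apply/fintype.subsetP => k; rewrite !inE; apply: contraLR.
  rewrite negb_or -!leNgt => /andP[h1 h2].
  apply: le_trans (ler_distD (Num.sqrt N%:R * Phi k.1 k.2) _ _) _.
  by have := lerD h1 h2; lra.
(* |b2| / 1600 <= 8 N p / K with K >= 10^8. *)
have b2N : (1400 * #|b2| <= p * N)%N.
  have cb2 : #|b2|%:R * (1 / 1600) <=
      \sum_i \sum_j (Num.sqrt N%:R * Phi i j - (-1) ^+ tnth s i j) ^+ 2.
    rewrite pair_bigA /= mulr_natl -sumr_const.
    rewrite [leRHS](bigID (mem b2)) /= ler_wpDr ?sumr_ge0//.
      by move=> k _; exact: sqr_ge0.
    apply: ler_sum => k; rewrite inE ffunE => h.
    by rewrite -real_normK ?num_real//; nra.
  have N0R : 0 < N%:R :> R by rewrite ltr0n.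
  have p0R : 0 < p%:R :> R by rewrite ltr0n.
  have K0R : 0 < K%:R :> R by rewrite ltr0n; lia.
  have {}cb2 : K%:R * (#|b2|%:R * (1 / 1600)) <= 8 * N%:R * p%:R :> R.
    by apply: le_trans Phis; rewrite ler_pM2l.
  rewrite -(ler_nat R) !natrM.
  have : 100 ^+ 4 * (#|b2|%:R * (1 / 1600)) <= 8 * N%:R * p%:R :> R.
    by apply: le_trans cb2; apply: ler_wpM2r KR; apply: mulr_ge0; [exact: ler0n|lra].
  move: (#|b2|%:R : R) (ler0n R #|b2|) (mulr_gt0 p0R N0R) => x x0 pN0.
  rewrite -mulrA [N%:R * _]mulrC; move: (p%:R * N%:R) pN0 => y y0.
  lra.
lia.
Qed.

(** * Step functions and sample points *)

Local Open Scope classical_set_scope.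
Local Open Scope ring_scope.

Definition cell (R : realType) (N : nat) (j : 'I_N) : set R :=
  `]j%:R / N%:R, j.+1%:R / N%:R[%classic.

Definition step_fun (R : realType) (N : nat) (v : 'I_N -> R) (x : R) : R :=
  \sum_j v j * \1_(cell j) x.

Lemma measurable_cell (R : realType) (N : nat) (j : 'I_N) :
  measurable (@cell R N j).
Proof. exact: measurable_itv. Qed.

Lemma cell_inj (R : realType) (N : nat) (j k : 'I_N) (x : R) :
  (0 < N)%N -> cell j x -> cell k x -> j = k.
Proof.
move=> N0; have NR : 0 < N%:R :> R by rewrite ltr0n.
rewrite /cell /= !in_itv /= => /andP[j1 j2] /andP[k1 k2]; apply: val_inj => /=.
have := lt_trans j1 k2; have := lt_trans k1 j2.
rewrite !ltr_pM2r ?invr_gt0// !ltr_nat => *; lia.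
Qed.

Lemma cell_sub (R : realType) (N : nat) (j : 'I_N) :
  (0 < N)%N -> @cell R N j `<=` @unit_itv R.
Proof.
move=> N0; have NR : 0 < N%:R :> R by rewrite ltr0n.
move=> x; rewrite /cell /unit_itv /= !in_itv /= => /andP[x1 x2].
apply/andP; split; first by apply: le_lt_trans x1; rewrite divr_ge0.
by apply: (lt_le_trans x2); rewrite ler_pdivrMr// mul1r ler_nat.
Qed.

Lemma mu_cell (R : realType) (N : nat) (j : 'I_N) :
  (0 < N)%N -> @lebesgue_measure R (cell j) = (N%:R^-1)%:E.
Proof.
move=> N0; have NR : 0 < N%:R :> R by rewrite ltr0n.
rewrite /cell lebesgue_measure_itv /= lte_fin ltr_pM2r ?invr_gt0// ltr_nat ltnSn.
by rewrite -EFinD -mulrBl -natrB// subSnn mul1r.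
Qed.

Lemma mu_unit_itv (R : realType) : @lebesgue_measure R (@unit_itv R) = 1%E.
Proof. by rewrite /unit_itv lebesgue_measure_itv /= lte_fin ltr01 oppr0 adde0. Qed.

Lemma step_fun_cell (R : realType) (N : nat) (v : 'I_N -> R) (j : 'I_N) (x : R) :
  (0 < N)%N -> cell j x -> step_fun v x = v j.
Proof.
move=> N0 jx; rewrite /step_fun (bigD1 j)//= big1 => [|k kj].
  by rewrite indicE mem_set// mulr1 addr0.
rewrite indicE memNset ?mulr0// => kx.
by move: kj; rewrite (cell_inj N0 kx jx) eqxx.
Qed.

Lemma measurable_step_fun (R : realType) (N : nat) (v : 'I_N -> R) (D : set R) :
  measurable_fun D (step_fun v).
Proof.
apply: measurable_sum => j; apply: measurable_funM => //.
by apply: measurable_indic; exact: measurable_cell.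
Qed.

Lemma step_fun_DN (R : realType) (N : nat) (v : 'I_N -> R) :
  (0 < N)%N -> @DN R N (step_fun v).
Proof. by move=> N0 j; exists (v j) => x xj; exact: step_fun_cell. Qed.

Lemma L2_inner_step_fun (R : realType) (N : nat) (u v : 'I_N -> R) :
  (0 < N)%N ->
  L2_inner (step_fun u) (step_fun v) = N%:R^-1 * \sum_j u j * v j.
Proof.
move=> N0; rewrite /L2_inner.
have -> : (fun x => step_fun u x * step_fun v x) = step_fun (fun j => u j * v j).
  apply/funext => x.
  have [[j jx]|H] := pselect (exists j : 'I_N, cell j x).
    by rewrite !(step_fun_cell _ N0 jx).
  have z (w : 'I_N -> R) : step_fun w x = 0.
    rewrite /step_fun big1// => j _; rewrite indicE memNset ?mulr0// => jx.
    by apply: H; exists j.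
  by rewrite !z mul0r.
have mD : measurable (@unit_itv R) by exact: measurable_itv.
rewrite /step_fun /Rintegral.
under eq_integral do rewrite -sumEFin.
rewrite integral_sum//=; last first.
  move=> j; under [X in integrable _ _ X]eq_fun do rewrite EFinM.
  apply: integrableZl => //.
  apply: (@integrableS _ _ _ _ setT) => //.
  exact: integrable_indic_itv.
have E j : (\int[@lebesgue_measure R]_(x in @unit_itv R) (u j * v j * \1_(cell j) x)%:E =
    (u j * v j * N%:R^-1)%:E)%E.
  under eq_integral do rewrite EFinM.
  rewrite integralZl//; last first.
    apply: (@integrableS _ _ _ _ setT) => //.
    exact: integrable_indic_itv.
  rewrite integral_indic//; last exact: measurable_cell.
  rewrite setIidl; last exact: cell_sub.
  by rewrite [X in (_ * X)%E](mu_cell R j N0) -EFinM.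
under eq_bigr do rewrite E.
by rewrite sumEFin /= -mulr_suml mulrC.
Qed.

(** A point where the number of sets containing it is minimal: this minimum is at
    most the mean of the counting function over [I]. *)
Lemma exists_low_count (R : realType) (I : set R) (p : nat) (A : 'I_p -> set R) :
  measurable I -> I !=set0 -> (forall r, measurable (A r)) ->
  exists2 x, I x &
    ((\sum_r (x \in A r))%:R%:E * @lebesgue_measure R I <=
      \sum_r @lebesgue_measure R (A r `&` I))%E.
Proof.
move=> mI [x1 Ix1] mA; pose c x := (\sum_r (x \in A r))%N.
have ex : exists n, `[< exists2 x, I x & c x = n >].
  by exists (c x1); apply/asboolP; exists x1.
case: (ex_minnP ex) => m /asboolP[x0 Ix0 cx0] mmin.
exists x0 => //; rewrite -/(c x0) cx0 -integral_cst//.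
have cE x : (c x)%:R%:E = (\sum_r (\1_(A r) x : R)%:E)%E.
  by rewrite /c natr_sum -sumEFin; apply: eq_bigr => r _; rewrite indicE.
have -> : (\sum_r @lebesgue_measure R (A r `&` I) =
    \int[@lebesgue_measure R]_(x in I) (c x)%:R%:E)%E.
  under [RHS]eq_integral do rewrite cE.
  rewrite ge0_integral_sum//=.
  - apply: eq_bigr => r _; rewrite integral_indic; [reflexivity|exact: mI|exact: mA].
  - by move=> r; apply/measurable_EFinP; apply: measurable_indic; exact: mA.
apply: ge0_le_integral => //.
- by move=> x _; rewrite lee_fin.
- apply/measurable_EFinP.
  rewrite (_ : (fun x => _) = (fun x => \sum_r (\1_(A r) x : R))).
    by apply: measurable_sum => r; apply: measurable_indic; exact: mA.
  by apply/funext => x; rewrite natr_sum; apply: eq_bigr => r _; rewrite indicE.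
- by move=> x Ix; rewrite lee_fin ler_nat; apply: mmin; apply/asboolP; exists x.
Qed.

(** * The distance in L_0 *)

Local Notation mu := (@lebesgue_measure _).
Local Notation I01 := (@unit_itv _).

Lemma measurable_unit_itv (R : realType) : measurable (@unit_itv R).
Proof. exact: measurable_itv. Qed.

Lemma mu_sub_unit_itv (R : realType) (A : set R) : measurable A -> A `<=` I01 -> (mu A <= 1)%E.
Proof.
by move=> mA sA; rewrite -(mu_unit_itv R) le_measure ?inE//; exact: measurable_unit_itv.
Qed.

Lemma L0_measurable_ge (R : realType) (f : R -> R) (t : R) : @L0 R f ->
  measurable (I01 `&` [set x | t <= `|f x|]).
Proof.
move=> mf; have mn : measurable_fun I01 (fun x => `|f x|) by exact: measurableT_comp.
have := mn (@measurable_unit_itv R) _ (measurable_itv `[t, +oo[).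
by congr (measurable (_ `&` _)); apply/seteqP; split=> x /=; rewrite in_itv /= andbT.
Qed.

Lemma L0_measurable_gt (R : realType) (f : R -> R) (t : R) : @L0 R f ->
  measurable (I01 `&` [set x | t < `|f x|]).
Proof.
move=> mf; have mn : measurable_fun I01 (fun x => `|f x|) by exact: measurableT_comp.
have := mn (@measurable_unit_itv R) _ (measurable_itv `]t, +oo[).
by congr (measurable (_ `&` _)); apply/seteqP; split=> x /=; rewrite in_itv /= andbT.
Qed.

Lemma L0norm_set_ubound (R : realType) (f : R -> R) : @L0 R f ->
  has_ubound [set t : R | 0 <= t /\ (t%:E <= mu (I01 `&` [set x | (t <= `|f x|)%R]))%E].
Proof.
move=> mf; exists 1 => t [t0 tmu]; rewrite -lee_fin; apply: (le_trans tmu).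
by apply: mu_sub_unit_itv; [exact: L0_measurable_ge|exact: subIsetl].
Qed.

Lemma L0norm_ge0 (R : realType) (f : R -> R) : @L0 R f -> 0 <= L0norm f.
Proof.
move=> mf; apply: ub_le_sup; first exact: L0norm_set_ubound.
by split=> //; exact: measure_ge0.
Qed.

Lemma mu_lt_of_L0norm_lt (R : realType) (f : R -> R) (t : R) : @L0 R f -> L0norm f < t ->
  (mu (I01 `&` [set x | (t <= `|f x|)%R]) < t%:E)%E.
Proof.
move=> mf ft; rewrite ltNge; apply/negP => tmu.
have t0 := le_trans (L0norm_ge0 mf) (ltW ft).
by move: ft; rewrite ltNge ub_le_sup//; exact: L0norm_set_ubound.
Qed.

(** For t <= 1/40 the bad set lies, up to a null set, in the set which
    L0norm (f - y) < t controls; for larger t the bound is trivial since 40 t > 1. *)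
Lemma mu_bad_le (R : realType) (f y h : R -> R) (t : R) :
  @L0 R f -> @L0 R y -> @L0 R h -> ae_eq mu I01 y h -> L0norm (f - y) < t ->
  (mu (I01 `&` [set x | (1 / 40 < `|(f - h) x|)%R]) <= (40 * t)%:E)%E.
Proof.
move=> mf my mh [Z [mZ Z0 ZP]] fyt.
have mfy : @L0 R (f - y) by exact: measurable_funB.
have mfh : @L0 R (f - h) by exact: measurable_funB.
have t0 : 0 < t := le_lt_trans (L0norm_ge0 mfy) fyt.
have [t40|t40] := leP t (1 / 40); last first.
  apply: (@le_trans _ _ 1%E); last by rewrite lee_fin; lra.
  by apply: mu_sub_unit_itv; [exact: L0_measurable_gt|exact: subIsetl].
apply: (@le_trans _ _ t%:E); last by rewrite lee_fin; lra.
apply: ltW; apply: le_lt_trans (mu_lt_of_L0norm_lt mfy fyt).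
have mA := L0_measurable_ge t mfy.
have <- : mu ((I01 `&` [set x | t <= `|(f - y) x|]) `|` Z) =
    mu (I01 `&` [set x | t <= `|(f - y) x|]) by exact: measureU0.
apply: le_measure; rewrite ?inE.
- exact: L0_measurable_gt.
- exact: measurableU.
move=> x [Ix /= bx].
have [Zx|nZx] := pselect (Z x); [by right|left].
split=> //=; apply: le_trans t40 _; apply: ltW.
have -> // : (f - y) x = (f - h) x.
congr (f x - _); apply: contrapT => yh; apply: nZx; apply: ZP => /=.
by move=> /(_ Ix).
Qed.

Lemma L0norm_image_lbound (R : realType) (f : R -> R) (Q : set (R -> R)) :
  @L0 R f -> Q `<=` @L0 R -> lbound [set L0norm (f - y) | y in Q] 0.
Proof.
by move=> mf QL _ [y Qy <-]; apply: L0norm_ge0; apply: measurable_funB => //; exact: QL.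
Qed.

Lemma L0dist_to_ge0 (R : realType) (f : R -> R) (Q : set (R -> R)) :
  @L0 R f -> Q `<=` @L0 R -> Q !=set0 -> 0 <= L0dist_to f Q.
Proof.
move=> mf QL [y Qy]; apply: lb_le_inf; first by exists (L0norm (f - y)); exists y.
exact: L0norm_image_lbound.
Qed.

Lemma L0dist_to_adherent (R : realType) (f : R -> R) (Q : set (R -> R)) (e : R) :
  @L0 R f -> Q `<=` @L0 R -> Q !=set0 -> 0 < e ->
  exists2 y, Q y & L0norm (f - y) < L0dist_to f Q + e.
Proof.
move=> mf QL [y Qy] e0.
have [|_ [z Qz <-] zlt] := inf_adherent e0 (_ : has_inf [set L0norm (f - y) | y in Q]).
  split; first by exists (L0norm (f - y)); exists y.
  by exists 0; exact: L0norm_image_lbound.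
by exists z.
Qed.

(** The number of bad entries in a column is the number of bad sets containing
    the sample point of that interval, so the points can be chosen one interval
    at a time. *)
Lemma sample_points (R : realType) (N p : nat) (v : 'I_p -> 'I_N -> R) (h : 'I_p -> R -> R)
    (b : 'I_p -> R) : (0 < N)%N -> (forall r, @L0 R (h r)) ->
  (forall r, (mu (I01 `&` [set x | (1 / 40 < `|(step_fun (v r) - h r) x|)%R]) <=
     (b r)%:E)%E) ->
  exists2 x : 'I_N -> R, forall j, cell j (x j) &
    #|[set k : 'I_p * 'I_N |
        1 / 40 < `|h k.1 (x k.2) - v k.1 k.2| ]%SET|%:R <= N%:R * \sum_r b r.
Proof.
move=> N0 mh bP.
pose A r := I01 `&` [set x | 1 / 40 < `|(step_fun (v r) - h r) x|].
have mA r : measurable (A r).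
  by apply: L0_measurable_gt; apply: measurable_funB; [exact: measurable_step_fun|exact: mh].
have NR : 0 < N%:R :> R by rewrite ltr0n.
have ex (j : 'I_N) : exists x : R, cell j x /\
    ((\sum_r (x \in A r))%:R%:E * mu (cell j) <= \sum_r mu (A r `&` cell j))%E.
  have c0 : @cell R N j !=set0.
    apply/set0P/eqP => c0; have := mu_cell R j N0; rewrite c0 measure0 => -[].
    by apply/eqP; rewrite eq_sym invr_neq0// gt_eqF.
  by have [x ? ?] := exists_low_count (@measurable_cell R N j) c0 mA; exists x.
have [x xP] := choice ex; exists x; first by move=> j; exact: (xP j).1.
have cardE : #|[set k : 'I_p * 'I_N |
        1 / 40 < `|h k.1 (x k.2) - v k.1 k.2| ]%SET| =
    (\sum_j \sum_r (x j \in A r))%N.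
  rewrite exchange_big pair_big /= -sum1_card big_mkcond /=.
  apply: eq_bigr => -[r j] _; rewrite !inE /=.
  have jx := (xP j).1.
  have -> : (x j \in A r) = (1 / 40 < `|h r (x j) - v r j|).
    have sE : (step_fun (v r) - h r) (x j) = v r j - h r (x j).
      by rewrite -(step_fun_cell (v r) N0 jx).
    rewrite distrC -sE; apply/idP/idP => [|lt]; rewrite inE; first by case.
    by split=> //; exact: (cell_sub N0 jx).
  by case: ifP.
rewrite cardE -lee_fin natr_sum.
have H : ((\sum_j (\sum_r (x j \in A r))%:R * N%:R^-1)%:E <= (\sum_r b r)%:E)%E.
  rewrite -!sumEFin; apply: (@le_trans _ _ (\sum_j \sum_r mu (A r `&` cell j))%E).
    by apply: lee_sum => j _; rewrite EFinM -(mu_cell R j N0); exact: (xP j).2.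
  rewrite exchange_big /=; apply: lee_sum => r _; apply: le_trans (bP r).
  rewrite -measure_bigsetU_ord //=.
  - apply: le_measure; rewrite ?inE; [|exact: mA|].
      by apply: bigsetU_measurable => j _; apply: measurableI; [exact: mA|exact: measurable_cell].
    by elim/big_ind: _ => [|B C sB sC|j _]; [exact: sub0set|rewrite subUset|move=> z []].
  - by move=> j; apply: measurableI; [exact: mA|exact: measurable_cell].
  - by move=> j k _ _ [z [[_ zj] [_ zk]]]; exact: (cell_inj N0 zj zk).
move: H; rewrite !lee_fin -mulr_suml => H.
by rewrite mulrC -ler_pdivrMr.
Qed.

(** * The rigid orthonormal system *)

Lemma subspace_dim_le0 (R : realType) (n : nat) :
  @subspace_dim_le R n [set f | f = 0].
Proof.
split=> [f ->||]; first exact: measurable_cst.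
  split=> [|a u v]; first by rewrite inE.
  by rewrite !inE => -> ->; rewrite scaler0 addr0.
exists (fun=> 0) => // f ->; exists (fun=> 0); apply: aeW => x _.
by rewrite big1// => l _; rewrite scaler0.
Qed.

(** Approximants from an [n]-dimensional subspace are combinations of [n]
    functions, so their values at the sample points form a matrix of rank at
    most [n].  If the average distance were below [c], the number of its bad
    entries would be at most N * 40 * 2cN, contradicting rigidity. *)
Lemma davg_step_fun_ge (R : realType) (N p n0 n K : nat) (c : R)
    (Psi : 'I_N -> 'I_N -> R) (f : 'I_p -> 'I_N) :
  (0 < N)%N -> (p <= N)%N -> (N <= K * p)%N -> injective f -> 0 < c ->
  c * (1400 * 80) * K%:R <= 1 -> (n <= n0)%N ->
  (forall B : 'M[R]_(p, N), (\rank B <= n0)%N ->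
    (p * N < 1400 *
      #|[set k : 'I_p * 'I_N | (1 / 40 < `|B k.1 k.2 - Psi (f k.1) k.2|)%R]%SET|)%N) ->
  c <= davg_L0 n (fun i => step_fun (Psi i)).
Proof.
move=> N0 pN NKp finj c0 cK nn0 rigid.
have NR : 0 < N%:R :> R by rewrite ltr0n.
apply: lb_le_inf.
  by eexists; exists [set f | f = 0]; [exact: subspace_dim_le0|].
move=> _ [Q [QL Qsub [g gQ gspan]] <-].
have Q0 : Q !=set0 by exists 0; have [/= + _] := Qsub; rewrite inE.
pose phi i : R -> R := step_fun (Psi i).
have phiL i : @L0 R (phi i) by exact: measurable_step_fun.
have hL (a : 'I_n -> R) : @L0 R (\sum_(l < n) a l *: g l).
  have -> : \sum_(l < n) a l *: g l = (fun x => \sum_(l < n) a l * g l x).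
    by apply/funext => x; rewrite fct_sumE.
  apply: measurable_sum => l; apply: measurable_funM => //; exact: QL.
rewrite leNgt; apply/negP => avg.
pose dist i := L0dist_to (phi i) Q.
have dist0 i : 0 <= dist i by exact: L0dist_to_ge0.
have distN : \sum_i dist i < c * N%:R.
  by rewrite -ltr_pdivrMr// mulrC.
have distp : \sum_r dist (f r) <= \sum_i dist i.
  have <- : \sum_(i in [set f r | r : 'I_p]%SET) dist i = \sum_r dist (f r).
    by rewrite big_imset //=; exact: in2W.
  rewrite [leRHS](bigID (mem [set f r | r : 'I_p]%SET)) /=.
  by rewrite ler_wpDr// sumr_ge0.
(* An almost best approximant, with the slack [c] for the infimum. *)
have ex (r : 'I_p) : exists a : 'I_n -> R,
    (@lebesgue_measure R (@unit_itv R `&` [set x |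
      (1 / 40 < `|(step_fun (Psi (f r)) - \sum_(l < n) a l *: g l) x|)%R])
      <= (40 * (dist (f r) + c))%:E)%E.
  have [y Qy yd] := L0dist_to_adherent (phiL (f r)) QL Q0 c0.
  have [a ya] := gspan y Qy.
  by exists a; apply: mu_bad_le yd => //; exact: QL.
have [a aP] := choice ex.
have [x xc xbad] := sample_points N0 (fun r => hL (a r)) aP.
pose B : 'M[R]_(p, N) :=
  (\matrix_(r < p, l < n) a r l) *m (\matrix_(l < n, j < N) g l (x j)).
have Bn : (\rank B <= n0)%N.
  exact: leq_trans (mulmx_max_rank _ _) nn0.
have := rigid B Bn.
have -> : [set k : 'I_p * 'I_N | 1 / 40 < `|B k.1 k.2 - Psi (f k.1) k.2|]%SET =
    [set k : 'I_p * 'I_N | 1 / 40 <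
       `|(\sum_(l < n) a k.1 l *: g l) (x k.2) - Psi (f k.1) k.2|]%SET.
  apply/setP => k; rewrite !inE; congr (_ < `|_ - _|).
  by rewrite mxE fct_sumE; apply: eq_bigr => l _; rewrite !mxE.
rewrite -(ltr_nat R) !natrM => lt1.
have {}xbad := lt_le_trans lt1 (ler_wpM2l (ler0n R 1400) xbad).
move: xbad; apply/negP; rewrite -leNgt.
rewrite -mulr_sumr big_split /= sumr_const card_ord -[c *+ p]mulr_natr.
have pNR : p%:R <= N%:R :> R by rewrite ler_nat.
have NKpR : N%:R <= K%:R * p%:R :> R by rewrite -natrM ler_nat.
have S : \sum_r dist (f r) + c * p%:R <= 2 * c * N%:R.
  have := ler_wpM2l (ltW c0) pNR.
  by have := le_lt_trans distp distN; lra.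
have S2 : \sum_r dist (f r) + c * p%:R <= 2 * c * (K%:R * p%:R).
  by apply: (le_trans S); rewrite ler_wpM2l// mulr_ge0// ltW.
apply: (@le_trans _ _ (1400 * (N%:R * (40 * (2 * c * (K%:R * p%:R)))))).
  apply: ler_wpM2l; first exact: ler0n.
  apply: ler_wpM2l; first exact: ltW.
  by apply: ler_wpM2l S2; exact: ler0n.
have -> : 1400 * (N%:R * (40 * (2 * c * (K%:R * p%:R)))) =
   (c * (1400 * 80) * K%:R) * (p%:R * N%:R) by ring.
by rewrite -[leRHS]mul1r ler_wpM2r// mulr_ge0.
Qed.

Theorem corollary3p4 (R : realType) :
  exists2 c : R, 0 < c &
    forall N : nat, (0 < N)%N ->
      exists phi : 'I_N -> R -> R,
        [/\ forall i : 'I_N, @DN R N (phi i),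
            orthonormal_L2 phi &
            forall n : nat, n%:R <= c * N%:R -> c <= davg_L0 n phi].
Proof.
have [K KE] : exists K : nat, K%:R = 100 ^+ 4 :> R.
  by exists (100 ^ 4)%N; rewrite natrX.
pose c : R := 100^-1 ^+ 7.
have c0 : 0 < c by rewrite exprn_gt0// invr_gt0.
have cK : c * K%:R = 100^-1 ^+ 3 by rewrite KE /c; field.
have K1 : (0 < K)%N by rewrite -(ltr_nat R) KE exprn_gt0.
exists c => // N N0.
(* This is the ceiling of N / K, so p >= N / K even when N < K. *)
pose p := (N.-1 %/ K).+1.
pose n0 := Num.truncn (c * N%:R).
have KpN : (K * p.-1 <= N)%N.
  by rewrite mulnC (leq_trans (leq_divM _ _))// leq_pred.
have NKp : (N <= K * p)%N.
  by have := ltn_ceil N.-1 K1; rewrite prednK// mulnC.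
have pN : (p <= N)%N.
  by rewrite /p -[leqRHS](prednK N0) ltnS leq_div.
have n0N : n0%:R <= c * N%:R by rewrite truncn_le// mulr_ge0// ltW.
have n0p : (700 * (n0 * (p + N)) <= p * N)%N.
  rewrite -(ler_nat R) !natrM natrD.
  have NKpR : N%:R <= K%:R * p%:R :> R by rewrite -natrM ler_nat.
  have pNR : p%:R <= N%:R :> R by rewrite ler_nat.
  have n0R : 1400 * n0%:R <= p%:R :> R.
    have := le_trans n0N (ler_wpM2l (ltW c0) NKpR).
    rewrite mulrA cK; have : 0 <= p%:R :> R by exact: ler0n.
    by lra.
  apply: (@le_trans _ _ (1400 * n0%:R * N%:R)); last by rewrite ler_wpM2r.
  have := ler_wpM2l (ler0n R n0) pNR; lra.
have KR : 100 ^+ 4 <= K%:R :> R by rewrite KE.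
have [Phi Phi1 rigid] := rigid_orthonormal_rows N0 (ltn0Sn _) KR KpN n0p.
have [Psi Psi1 [f finj fPsi]] := orthonormal_completion Phi1 pN.
pose s : R := Num.sqrt N%:R.
have s2 : s * s = N%:R by rewrite -expr2 sqr_sqrtr.
exists (fun i => step_fun (fun j => s * Psi i j)); split.
- by move=> i; exact: step_fun_DN.
- move=> i j; rewrite L2_inner_step_fun//.
  have := congr1 (fun M : 'M[R]_N => M i j) Psi1; rewrite !mxE => <-.
  rewrite mulr_sumr; apply: eq_bigr => k _; rewrite mxE.
  rewrite [X in _ * X](_ : _ = N%:R * (Psi i k * Psi j k)); last by rewrite -s2; ring.
  by rewrite mulKf// pnatr_eq0 -lt0n.
move=> n nN.
have cK1 : c * (1400 * 80) * K%:R <= 1 by rewrite mulrAC cK; lra.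
have nn0 : (n <= n0)%N.
  by rewrite truncn_ge_nat//; apply: mulr_ge0; [exact: ltW|exact: ler0n].
apply: (davg_step_fun_ge N0 pN NKp finj c0 cK1 nn0) => B Bn.
by have := rigid B Bn; under eq_finset do rewrite -fPsi.
Qed.
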